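(* Assume (A1) differentiability, (A2) convexity, (A3) $\mu$-strong convexity of $f$, (A4) interpolation and (SS) Star Similarity with constant $\delta_*>0$ (with respect to the minimizer $x_*$ of $f$, which satisfies (A4)). Consider SPPM-inexact in which every inexact prox satisfies (IP) with parameters $\eta,\alpha>0$ and $T$ inner iterations. If $0<\gamma\le\frac{\mu}{4\delta_*^2}$ and $T$ is large enough that $\frac{\eta\gamma^2}{T^\alpha}\le c<1$, then for every $k\ge0$, $$\mathbb{E}\big[\|x_k-x_*\|^2\big]\le\left(1-\min\Big(\frac{\gamma\mu}{4},\frac{1-c}{2}\Big)\right)^k\|x_0-x_*\|^2 .$$
   Context: Setting: $\mathcal{D}$ is a probability distribution over samples $\xi$; for each $\xi$, $f_\xi:\mathbb{R}^d\to\mathbb{R}$; $f(x)=\mathbb{E}_{\xi\sim\mathcal{D}}[f_\xi(x)]$, with $\nabla f(x)=\mathbb{E}[\nabla f_\xi(x)]$. Assumptions: (A1) $f_\xi$ differentiable for $\mathcal{D}$-a.e. $\xi$; (A2) $f_\xi$ convex for $\mathcal{D}$-a.e. $\xi$; (A3) $f$ is $\mu$-strongly convex; (A4) (interpolation) there exists $x_*$ with $\nabla f_\xi(x_* )=0$ for $\mathcal{D}$-a.e. $\xi$; (SS) (Star Similarity) there exist a minimizer $x_*$ of $f$ and $\delta_*>0$ with $\mathbb{E}_{\xi}\big[\|\nabla f_\xi(x)-\nabla f(x)-\nabla f_\xi(x_* )\|^2\big]\le\delta_*^2\|x-x_*\|^2$ for all $x$. SPPM-inexact: given $\gamma>0$,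 $x_0$, and i.i.d. $\xi_0,\xi_1,\dots\sim\mathcal{D}$, at iteration $k$ let $\Psi_k(x):=f_{\xi_k}(x)+\frac{1}{2\gamma}\|x-x_k\|^2$ with exact minimizer $x_k^\Psi$; an approximate minimizer $\hat x_k$ of $\Psi_k$ is computed and $x_{k+1}:=x_k-\gamma\nabla f_{\xi_k}(\hat x_k)$. (IP): at each iteration $k$, the subroutine after $T$ iterations returns $\hat x_k$ with $\|\nabla\Psi_k(\hat x_k)\|^2\le\frac{\eta\|x_k-x_k^\Psi\|^2}{T^\alpha}$, $\eta,\alpha>0$. *)

(* Defs.v *)
From HB Require Import structures.
From mathcomp Require Import all_boot all_order all_algebra.
From mathcomp Require Import all_classical all_reals all_analysis.
Set Implicit Arguments. Unset Strict Implicit. Unset Printing Implicit Defensive.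
Import Order.TTheory GRing.Theory Num.Theory.
Import numFieldNormedType.Exports.
Local Open Scope ring_scope.
Local Open Scope classical_set_scope.

Section Defs.
Variable R : realType.

Definition dotv (d : nat) (u v : 'rV[R]_d) : R := \sum_(i < d) u 0 i * v 0 i.
Definition sqnorm (d : nat) (v : 'rV[R]_d) : R := dotv v v.

Definition has_gradient_at (d : nat) (f : 'rV[R]_d -> R) (x g : 'rV[R]_d) : Prop :=
  differentiable f x /\ forall v : 'rV[R]_d, 'd f x v = dotv g v.

Definition convexf (d : nat) (f : 'rV[R]_d -> R) : Prop :=
  forall (x y : 'rV[R]_d) (t : R), 0 <= t <= 1 ->
    f (t *: x + (1 - t) *: y) <= t * f x + (1 - t) * f y.

Definition strongly_convex (d : nat) (mu : R) (f : 'rV[R]_d -> R)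
  (gf : 'rV[R]_d -> 'rV[R]_d) : Prop :=
  forall x y : 'rV[R]_d,
    f x + dotv (gf x) (y - x) + mu / 2 * sqnorm (y - x) <= f y.

(* SPPM-inexact iterates, as a function of the sample history h, listed
   most recent sample first: iterate (xi_{k-1} :: ... :: xi_0 :: [::]) = x_k.
   xhat (xi_k :: h) is the approximate prox point hat x_k returned by the
   subroutine at iteration k (history h of length k, current sample xi_k). *)
Fixpoint sppm_iterate (d : nat) (T : Type) (gF : T -> 'rV[R]_d -> 'rV[R]_d)
  (gamma : R) (x0 : 'rV[R]_d) (xhat : seq T -> 'rV[R]_d) (h : seq T)
  : 'rV[R]_d :=
  match h with
  | [::] => x0
  | xi :: h' => sppm_iterate gF gamma x0 xhat h' - gamma *: gF xi (xhat h)
  end.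

(* Expectation over k i.i.d. samples xi_0, ..., xi_{k-1} ~ P, written as the
   iterated integral (the most recent sample is integrated innermost). *)
Fixpoint iter_expect (d0 : measure_display) (T : measurableType d0)
  (P : probability T R) (k : nat) (g : seq T -> \bar R) : \bar R :=
  match k with
  | 0 => g [::]
  | k'.+1 => iter_expect P k' (fun h => (\int[P]_xi g (xi :: h))%E)
  end.

End Defs.

(* Main.v *)
(** Fix a past history, let [x] be the current iterate, [p] the exact proximal
    point for the current sample and [theta = 1 - c].  Convexity of the sample
    function gives, whatever the inexact point is,
      |x+ - xs|^2 <= |x - xs|^2 - 2 gamma (F p - F xs) - theta |x - p|^2.
    Since [p] depends on the sample, star similarity cannot be used at [p].
    Instead the decrease is bounded below through two deterministic points:
    [z' = prox_{gamma f}(x)], with [k = x - z'], and the point [z] satisfying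
    [gamma grad f(z) = (2 - theta) t + theta k], [t = z' - z].  Linearizing the
    sample function at [z] and using the monotonicity of its gradient between
    [p] and [z'], a sum-of-squares identity leaves only the gradient noises at
    [z] and [z'], whose second moments star similarity controls.  The expected
    decrease is then at least, with [m = gamma mu] and positions relative to
    [xs],
      3/4 m |z|^2 - (1 - theta)/4 m |z'|^2 + 2 (1 - theta) |t|^2 + theta |x - z|^2,
    which dominates min(m/4, theta/2) |x - xs|^2 when [m <= 4]; when [m > 4]
    one argues with [theta = 1] and rescales by [1 - c].  *)

Require Import Defs.
From HB Require Import structures.
From mathcomp Require Import all_boot all_order all_algebra.
From mathcomp Require Import all_classical all_reals all_analysis.
From mathcomp Require Import measurable_realfun ring lra.
Set Implicit Arguments.
Unset Strict Implicit.
Unset Printing Implicit Defensive.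
Import Order.TTheory GRing.Theory Num.Theory.
Import numFieldNormedType.Exports.
Local Open Scope ring_scope.
Local Open Scope classical_set_scope.

(** * Inner product, directional derivatives, minimizers of regularized functions *)

Section Vectors.
Context {R : realType} {d : nat}.
Implicit Types (u v w : 'rV[R]_d) (a : R).

Lemma dotvC u v : dotv u v = dotv v u.
Proof. by apply: eq_bigr => i _; rewrite mulrC. Qed.

Lemma dotvDl u v w : dotv (u + v) w = dotv u w + dotv v w.
Proof. by rewrite -big_split; apply: eq_bigr => i _; rewrite !mxE mulrDl. Qed.

Lemma dotvDr u v w : dotv w (u + v) = dotv w u + dotv w v.
Proof. by rewrite dotvC dotvDl !(dotvC w). Qed.

Lemma dotvZl a u v : dotv (a *: u) v = a * dotv u v.
Proof. by rewrite mulr_sumr; apply: eq_bigr => i _; rewrite !mxE mulrA. Qed.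

Lemma dotvZr a u v : dotv u (a *: v) = a * dotv u v.
Proof. by rewrite dotvC dotvZl dotvC. Qed.

Lemma dotvNl u v : dotv (- u) v = - dotv u v.
Proof. by rewrite -scaleN1r dotvZl mulN1r. Qed.

Lemma dotvNr u v : dotv u (- v) = - dotv u v.
Proof. by rewrite dotvC dotvNl dotvC. Qed.

Definition dotvE := (dotvDl, dotvDr, dotvNl, dotvNr, dotvZl, dotvZr).

Lemma sqnorm_ge0 u : 0 <= sqnorm u.
Proof. by apply: sumr_ge0 => i _; rewrite -expr2 sqr_ge0. Qed.

Lemma sqnormZ a u : sqnorm (a *: u) = a ^+ 2 * sqnorm u.
Proof. by rewrite /sqnorm !dotvE mulrA expr2. Qed.

Lemma sqr_coord_le_sqnorm u (i : 'I_d) : u 0 i ^+ 2 <= sqnorm u.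
Proof.
rewrite /sqnorm /dotv (bigD1 i)//= expr2 lerDl.
by apply: sumr_ge0 => j _; rewrite -expr2 sqr_ge0.
Qed.

Lemma continuous_sqnormB q : continuous (fun y : 'rV[R]_d => sqnorm (y - q)).
Proof.
apply: (@continuous_big R^o 'I_d +%R 0 xpredT _ 'rV[R]_d) => [|i _ y].
  exact: add_continuous.
pose c (z : 'rV[R]_d) : R^o := z 0 i.
have cc : {for y, continuous c} by exact: (@coord_continuous R 1 d 0 i y).
have cB : {for y, continuous (c - cst (q 0 i))}.
  by apply: continuousB => //; exact: cst_continuous.
rewrite [X in continuous_at _ X](_ : _ =
    (c - cst (q 0 i)) \* (c - cst (q 0 i))).
  exact: (continuousM cB cB).
by apply/funext => z; rewrite !mxE.
Qed.

(** The difference quotient along [v] is at most [K + t * C]; let [t] decrease to 0. *)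
Lemma gradient_dir_le (f : 'rV[R]_d -> R) x g v (K C : R) :
  has_gradient_at f x g ->
  (forall t, 0 < t < 1 -> f (x + t *: v) - f x <= t * K + t ^+ 2 * C) ->
  dotv g v <= K.
Proof.
move=> [df dfE] fK.
rewrite -dfE -deriveE //.
have cd : (fun h => h^-1 *: ((f \o shift x) (h *: v) - f x)) @ 0^'+
    --> 'D_v f x.
  have /cvg_ex [l hl] : derivable f x v by exact: diff_derivable.
  have -> : 'D_v f x = l by exact: cvg_lim hl.
  exact: cvg_dnbhs_at_right hl.
have ck : (fun h : R => K + h * C) @ 0^'+ --> K.
  rewrite -[X in _ --> X]addr0 -[X in _ --> _ + X](mul0r C).
  apply: cvg_at_right_filter.
  apply: cvgD; first exact: cvg_cst.
  by apply: cvgM; [exact: cvg_id|exact: cvg_cst].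
apply: (ler_cvg_to cd ck); near=> h.
have h01 : 0 < h < 1.
  by apply/andP; split; near: h; [exact: nbhs_right_gt|exact: nbhs_right_lt].
case/andP: (h01) => h0 _.
rewrite /= [_ + x]addrC -[_ *: _]/(h^-1 * _).
rewrite mulrC ler_pdivrMr // (le_trans (fK _ h01)) //.
by rewrite le_eqVlt; apply/orP; left; apply/eqP; ring.
Unshelve. all: by end_near. Qed.

Lemma gradient_dir_ge (f : 'rV[R]_d -> R) x g v (K C : R) :
  has_gradient_at f x g ->
  (forall t, 0 < t < 1 -> t * K - t ^+ 2 * C <= f (x + t *: v) - f x) ->
  K <= dotv g v.
Proof.
move=> [df dfE] fK.
have hN : has_gradient_at (- f) x (- g).
  split; first exact: differentiableN.
  by move=> w; rewrite diffN // dotvNl -dfE.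
have := @gradient_dir_le (- f) x (- g) v (- K) C hN.
rewrite dotvNl lerN2; apply => t t01.
have := fK t t01.
by rewrite !fctE; lra.
Qed.

Lemma convex_first_order (f : 'rV[R]_d -> R) x g y :
  convexf f -> has_gradient_at f x g -> f x + dotv g (y - x) <= f y.
Proof.
move=> cf hg; rewrite addrC -lerBrDr.
apply: (gradient_dir_le (C := 0) hg) => t /andP[t0 t1].
have /(cf y x) : 0 <= t <= 1 by rewrite !ltW.
have -> : t *: y + (1 - t) *: x = x + t *: (y - x).
  by rewrite scalerBr scalerBl scale1r addrC -addrA [- _ + _]addrC.
by lra.
Qed.

(** Minimize over a compact box around [q]. Outside it the quadratic outweighs the affine minorant,
    so no value falls below the one at [q]. *)
Lemma exists_prox_min (g : 'rV[R]_d -> R) (b q : 'rV[R]_d) (rho : R) :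
  continuous g -> 0 < rho ->
  (forall y, g q + dotv b (y - q) <= g y) ->
  exists z, forall y, g z + rho * sqnorm (z - q) <= g y + rho * sqnorm (y - q).
Proof.
move=> cg rho0 gb.
(* Outside the box [|y - q|^2 >= M^2 >= M], hence [|b|^2 <= rho^2 |y - q|^2]; with
   [|b + rho (y - q)|^2 >= 0] this bounds the affine term. *)
pose M := 1 + sqnorm b / rho ^+ 2.
have M1 : 1 <= M by rewrite lerDl divr_ge0 ?sqnorm_ge0 ?sqr_ge0.
pose A := [set v : 'rV[R]_d |
  forall i, `[q 0 i - M, q 0 i + M]%classic (v ord0 i)].
have Aq : A q by move=> i; rewrite /= in_itv /=; apply/andP; split; lra.
have cA : compact A.
  apply: (@rV_compact _ _ (fun i => `[q 0 i - M, q 0 i + M]%classic)) => i.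
  exact: segment_compact.
have cG : continuous (fun y : 'rV[R]_d => g y + rho * sqnorm (y - q)).
  move=> y; apply: (@continuousD R R^o 'rV[R]_d g); first exact: cg.
  apply: (@continuousM R 'rV[R]_d (cst rho)); first exact: cst_continuous.
  exact: continuous_sqnormB.
have [z _ zmin] := EVT_min_rV (ex_intro _ q Aq) cA (continuous_subspaceT cG).
exists z => y.
have [Ay|/existsNP[i /negP]] := pselect (A y); first by apply: zmin; rewrite inE.
rewrite /= in_itv /= negb_and -!ltNge => iM.
apply: (le_trans (zmin q _)); first by rewrite inE.
rewrite subrr /sqnorm {1}/dotv big1 ?mulr0 ?addr0; last first.
  by move=> j _; rewrite mxE mul0r.
apply: le_trans (lerD (gb y) (lexx _)); rewrite -addrA lerDl.
set w := y - q.
have wi : M ^+ 2 <= sqnorm w.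
  apply: le_trans (sqr_coord_le_sqnorm w i).
  rewrite !mxE; case/orP: iM => iM; nra.
clearbody w; have := sqnorm_ge0 (b + rho *: w).
rewrite {1}/sqnorm !dotvE (dotvC w b) -/(sqnorm b) -/(sqnorm w) => sq.
have bM : sqnorm b <= rho ^+ 2 * sqnorm w.
  rewrite mulrC -ler_pdivrMr ?exprn_gt0 //; move: M1 wi; rewrite /M.
  set r := _ / _; nra.
rewrite -(pmulr_rge0 _ rho0); nra.
Qed.

End Vectors.

(** * Proximal points and the deterministic inequalities *)

Section Prox.
Context {R : realType} {d : nat}.
Implicit Types (u v w x y z : 'rV[R]_d).

Lemma sqnorm_eq0 u : sqnorm u <= 0 -> u = 0.
Proof.
move=> u0; apply/rowP => i; rewrite mxE; apply/eqP.
rewrite -sqrf_eq0 eq_le sqr_ge0 andbT.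
exact: le_trans (sqr_coord_le_sqnorm u i) u0.
Qed.

Lemma dotv_le_eq u w : (forall v, dotv u v <= dotv w v) -> u = w.
Proof.
move=> uw; apply/eqP; rewrite -subr_eq0; apply/eqP/sqnorm_eq0.
by rewrite /sqnorm dotvDl dotvNl subr_le0.
Qed.

Lemma exists_prox (g : 'rV[R]_d -> R) (gg : 'rV[R]_d -> 'rV[R]_d) q (rho : R) :
  0 < rho -> (forall x, has_gradient_at g x (gg x)) ->
  (forall x y, g x + dotv (gg x) (y - x) <= g y) ->
  exists z, (forall y, g z + rho * sqnorm (z - q) <= g y + rho * sqnorm (y - q))
    /\ gg z = (2 * rho) *: (q - z).
Proof.
move=> rho0 hg fo.
have cg : continuous g.
  by move=> x; apply: differentiable_continuous; case: (hg x).
have [z zmin] := exists_prox_min cg rho0 (fo q).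
exists z; split=> //; apply/esym/dotv_le_eq => v.
apply: (gradient_dir_ge (C := rho * sqnorm v) (hg z)) => t /andP[t0 t1].
have := zmin (z + t *: v).
rewrite /sqnorm !dotvE ?(dotvC q z) ?(dotvC v z) ?(dotvC v q).
lra.
Qed.

(** Chain the linearization at [xh] towards [xs] with the one at [p] towards [xh]. Completing
    squares leaves the squared residual of [xh] minus [|x - p|^2 + |xh - p|^2]. *)
Lemma inexact_prox_descent (F : 'rV[R]_d -> R) (G : 'rV[R]_d -> 'rV[R]_d)
    x xs p xh (gamma c : R) :
  0 < gamma -> (forall x y, F x + dotv (G x) (y - x) <= F y) ->
  gamma *: G p = x - p ->
  sqnorm (gamma *: G xh + (xh - x)) <= c * sqnorm (x - p) ->
  sqnorm (x - gamma *: G xh - xs) <=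
    sqnorm (x - xs) - (2 * gamma * (F p - F xs) + (1 - c) * sqnorm (x - p)).
Proof.
move=> g0 fo Gp hxh.
have h1 := fo xh xs; have h2 := fo p xh.
rewrite -(ler_pM2l g0) mulrDr -dotvZl in h1.
rewrite -(ler_pM2l g0) mulrDr -dotvZl Gp in h2.
have h3 := sqnorm_ge0 (p - xh).
move: (gamma *: G xh) h1 hxh => W h1 hxh.
have eU : sqnorm (x - p) = sqnorm x - 2 * dotv x p + sqnorm p.
  rewrite /sqnorm !dotvE ?(dotvC p x); ring.
move: (sqnorm (x - p)) eU hxh => U eU hxh.
move: h1 h2 h3 hxh eU; rewrite /sqnorm !dotvE.
rewrite ?(dotvC p x) ?(dotvC xs x) ?(dotvC xh x) ?(dotvC W x) ?(dotvC xs W).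
rewrite ?(dotvC xh W) ?(dotvC p W) ?(dotvC xh p) ?(dotvC xs p) ?(dotvC xs xh).
lra.
Qed.

(* [v] and [v'] are the sampling noises of the gradient at the deterministic
   points [z] and [z']; the slack of the inequality is
   [|a + t + v|^2 + (1 - theta) |a + t + v'|^2] with [a = p - z']. *)
Lemma prox_gap_ge (F : 'rV[R]_d -> R) (G : 'rV[R]_d -> 'rV[R]_d)
    x xs p z' t v v' (gamma theta : R) :
  0 < gamma -> theta <= 1 ->
  (forall x y, F x + dotv (G x) (y - x) <= F y) ->
  gamma *: G p = x - p ->
  gamma *: G z' = x - z' + v' ->
  gamma *: G (z' - t) = (2 - theta) *: t + theta *: (x - z') + v ->
  2 * gamma * (F (z' - t) - F xs) + (2 - theta) * sqnorm t
    + 2 * theta * dotv (x - z') t + theta * sqnorm (x - z')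
    - 2 * (1 - theta) * dotv t v' - sqnorm v - (1 - theta) * sqnorm v'
  <= 2 * gamma * (F p - F xs) + theta * sqnorm (x - p).
Proof.
move=> g0 th1 fo Gp Gz' Gz.
have h1 := fo (z' - t) p; have h2 := fo z' p; have h3 := fo p z'.
rewrite -(ler_pM2l g0) mulrDr -dotvZl Gz in h1.
rewrite -(ler_pM2l g0) mulrDr -dotvZl Gz' in h2.
rewrite -(ler_pM2l g0) mulrDr -dotvZl Gp in h3.
pose a := p - z'; pose k := x - z'.
have ep : p - (z' - t) = a + t by rewrite opprB addrCA addrC.
have exp : x - p = k - a by rewrite /a opprB addrA subrK.
rewrite ep -/k -/a in h1.
rewrite -/k -/a in h2.
rewrite exp -opprB -/a in h3.
rewrite exp -/k.
have s1 := sqnorm_ge0 (a + t + v).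
have s2 := mulr_ge0 (_ : 0 <= 1 - theta) (sqnorm_ge0 (a + t + v')).
move: s2; rewrite subr_ge0 => /(_ th1) s2.
(* Gradient monotonicity between [p] and [z']: summing [h2] and [h3] cancels the values of [F] and
   the terms in [k]. *)
have h4 : 0 <= (1 - theta) * - (dotv a a + dotv v' a).
  rewrite mulr_ge0 ?subr_ge0 //.
  move: h2 h3; rewrite !dotvE; lra.
clearbody a k.
move: h1 s1 s2 h4; rewrite /sqnorm !dotvE.
rewrite ?(dotvC t a) ?(dotvC v a) ?(dotvC v' a) ?(dotvC k a) ?(dotvC v t).
rewrite ?(dotvC v' t) ?(dotvC k t).
lra.
Qed.

(* Conclusion of the optimisation over the unknown geometry: [z], [z + t] and
   [z + y] are the positions, relative to the solution, of the two reference
   points and of the current iterate. *)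
Lemma rate_small_step (m theta : R) z t y :
  0 < m -> 0 <= (1 - theta) * (4 - m) -> 0 < theta -> theta <= 1 ->
  Num.min (m / 4) (theta / 2) * sqnorm (z + y) <=
  3 / 4 * m * sqnorm z - 1 / 4 * (1 - theta) * m * sqnorm (z + t)
    + 2 * (1 - theta) * sqnorm t + theta * sqnorm y.
Proof.
move=> m0 m4 th0 th1.
have s0 := sqnorm_ge0 (z - y).
have zp : sqnorm (z + y) <= 2 * sqnorm z + 2 * sqnorm y.
  move: s0; rewrite /sqnorm !dotvE ?(dotvC y z); lra.
have := sqnorm_ge0 z; have := sqnorm_ge0 t; have := sqnorm_ge0 y.
move=> y0 t0 z0.
(* Young's inequality with weights [theta], [1 - theta] splits [|z + t|^2]; its [t] part fits into
   [2 (1 - theta) |t|^2] exactly when [m <= 8 theta]. Otherwise the [z] term is large enough for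
   equal weights, using [m <= 4] or [theta = 1]. *)
have [m8|m8] := leP m (8 * theta).
  have sq := sqnorm_ge0 (theta *: z - (1 - theta) *: t).
  have key : (1 - theta) * theta * sqnorm (z + t) <=
      theta * sqnorm z + (1 - theta) * sqnorm t.
    move: sq; rewrite /sqnorm !dotvE ?(dotvC t z); nra.
  apply: (@le_trans _ _ (m / 2 * sqnorm z + theta * sqnorm y)).
    have q0 : 0 <= Num.min (m / 4) (theta / 2) by rewrite le_min; apply/andP; split; lra.
    have q1 : Num.min (m / 4) (theta / 2) <= m / 4 by rewrite ge_min lexx.
    have q2 : Num.min (m / 4) (theta / 2) <= theta / 2.
      by rewrite ge_min lexx orbT.
    move: (Num.min _ _) q0 q1 q2 => q; nra.
  rewrite -subr_ge0 -(pmulr_rge0 _ th0).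
  have : 0 <= (8 * theta - m) * ((1 - theta) * sqnorm t).
    by rewrite !mulr_ge0 ?subr_ge0.
  have : 0 <= m * (theta * sqnorm z + (1 - theta) * sqnorm t
                   - (1 - theta) * theta * sqnorm (z + t)).
    by rewrite mulr_ge0 ?subr_ge0 // ltW.
  by lra.
have q2 : Num.min (m / 4) (theta / 2) <= theta / 2 by rewrite ge_min lexx orbT.
apply: (@le_trans _ _ (theta / 2 * sqnorm (z + y))).
  by rewrite ler_wpM2r ?sqnorm_ge0.
have zt : sqnorm (z + t) <= 2 * sqnorm z + 2 * sqnorm t.
  move: (sqnorm_ge0 (z - t)); rewrite /sqnorm !dotvE ?(dotvC t z); lra.
have k1 : 0 <= (1 - theta) * m * (2 * sqnorm z + 2 * sqnorm t - sqnorm (z + t)).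
  by rewrite !mulr_ge0 ?subr_ge0 // ltW.
have k2 : 0 <= (1 - theta) * (4 - m) * sqnorm t.
  by rewrite mulr_ge0.
have k3 : 0 <= (m - 8 * theta) * sqnorm z.
  by rewrite !mulr_ge0 ?subr_ge0 // ltW.
have k4 : 0 <= theta * m * sqnorm z by rewrite !mulr_ge0 // ltW.
have k5 : 0 <= theta * (2 * sqnorm z + 2 * sqnorm y - sqnorm (z + y)).
  by rewrite mulr_ge0 ?subr_ge0 // ltW.
have k6 : 0 <= theta * sqnorm z by rewrite mulr_ge0 // ltW.
lra.
Qed.

End Prox.

(** * Monotonicity for integrals of possibly non-measurable functions *)

Section LowerIntegral.
Context d (T : measurableType d) (R : realType).
Context (mu : {measure set T -> \bar R}).
Import HBNNSimple.

(* The integral of a nonnegative function is a supremum over simple functions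
   below it, so only the upper bound has to be measurable. *)
Lemma ae_ge0_le_lower_integral (f g : T -> \bar R) :
  (forall x, 0 <= f x)%E -> (forall x, 0 <= g x)%E -> measurable_fun setT g ->
  {ae mu, forall x, (f x <= g x)%E} ->
  (\int[mu]_x f x <= \int[mu]_x g x)%E.
Proof.
move=> f0 g0 mg fg; rewrite ge0_integralTE//.
apply: ge_ereal_sup => _ [h /= hf <-].
have -> : sintegral mu h = (\int[mu]_x (h x)%:E)%E.
  by rewrite integral_nnsfun// patch_setT.
apply: ae_ge0_le_integral => //.
- by move=> x _; rewrite lee_fin.
- by apply/measurable_EFinP.
- by apply: filterS fg => x fgx _; exact: le_trans (hf x) fgx.
Qed.

(** Comparing the simple functions below [f] and [g] suits iterates that may fail to be measurable
    in the samples, as [xhat] is arbitrary. *)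
Lemma ge0_le_lower_integral (f g : T -> \bar R) :
  (forall x, 0 <= f x)%E -> (forall x, f x <= g x)%E ->
  (\int[mu]_x f x <= \int[mu]_x g x)%E.
Proof.
move=> f0 fg.
have g0 x : (0 <= g x)%E by exact: le_trans (f0 x) (fg x).
rewrite !ge0_integralTE//; apply: ge_ereal_sup => _ [h /= hf <-].
by apply: ereal_sup_ubound; exists h => // x; exact: le_trans (hf x) (fg x).
Qed.

End LowerIntegral.

(** * Iterated expectations and a calculus of means *)

Section IterExpect.
Context d (T : measurableType d) (R : realType).
Context (P : probability T R).

Lemma iter_expect_le k (f g : seq T -> \bar R) :
  (forall h, 0 <= f h)%E -> (forall h, f h <= g h)%E ->
  (iter_expect P k f <= iter_expect P k g)%E.
Proof.
elim: k f g => [|k IH] f g f0 fg /=; first exact: fg.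
apply: IH => h; first exact: integral_ge0.
exact: ge0_le_lower_integral.
Qed.

(** Integrating the newest sample first, each factor [q] joins the weight [a], over which the
    induction ranges. Keeping weights under the integral avoids scaling a possibly non-measurable
    integrand. *)
Lemma iter_expect_geometric (V : seq T -> R) (q : R) k (a : R) :
  0 <= q -> (forall h, 0 <= V h) ->
  (forall h b, 0 <= b ->
    (\int[P]_xi (b * V (xi :: h))%:E <= (b * q * V h)%:E)%E) ->
  0 <= a ->
  (iter_expect P k (fun h => (a * V h)%:E) <= (a * q ^+ k * V [::])%:E)%E.
Proof.
move=> q0 V0 step; elim: k a => [|k IH] a a0 /=; first by rewrite expr0 mulr1.
apply: (@le_trans _ _ (iter_expect P k (fun h => (a * q * V h)%:E))).
  apply: iter_expect_le => h; last exact: step.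
  by apply: integral_ge0 => xi _; rewrite lee_fin mulr_ge0.
by rewrite exprS mulrA; apply: IH; rewrite mulr_ge0.
Qed.

Definition has_mean (f : T -> R) (r : R) : Prop :=
  P.-integrable setT (fun xi => (f xi)%:E) /\
  (\int[P]_xi (f xi)%:E)%E = r%:E.

Lemma has_mean_cst r : has_mean (cst r) r.
Proof.
split; first exact: finite_measure_integrable_cst.
have := integral_cst P measurableT r%:E; rewrite /= => ->.
have -> : P setT = 1%E by exact: probability_setT.
by rewrite mule1.
Qed.

Lemma has_meanD f g r s :
  has_mean f r -> has_mean g s -> has_mean (fun xi => f xi + g xi) (r + s).
Proof.
move=> [fi fr] [gi gs]; split; first exact: (integrableD measurableT fi gi).
by under eq_integral do rewrite EFinD; rewrite integralD// fr gs.
Qed.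

Lemma has_meanZ a f r : has_mean f r -> has_mean (fun xi => a * f xi) (a * r).
Proof.
move=> [fi fr]; split; first exact: (integrableZl measurableT a fi).
by under eq_integral do rewrite EFinM; rewrite integralZl// fr.
Qed.

Lemma has_meanN f r : has_mean f r -> has_mean (fun xi => - f xi) (- r).
Proof.
move=> /(has_meanZ (-1)); rewrite mulN1r.
by under eq_fun do rewrite mulN1r.
Qed.

Lemma has_mean_sum (I : Type) (s : seq I) (f : I -> T -> R) (r : I -> R) :
  (forall i, has_mean (f i) (r i)) ->
  has_mean (fun xi => \sum_(i <- s) f i xi) (\sum_(i <- s) r i).
Proof.
move=> fr; elim: s => [|i s IH].
  rewrite big_nil; under eq_fun do rewrite big_nil.
  exact: has_mean_cst.
rewrite big_cons; under eq_fun do rewrite big_cons.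
exact: has_meanD.
Qed.

Lemma has_mean_bounded (g : T -> R) B :
  measurable_fun setT g -> (forall xi, 0 <= g xi) ->
  (\int[P]_xi (g xi)%:E <= B%:E)%E -> exists2 r, has_mean g r & r <= B.
Proof.
move=> mg g0 gB.
have ge : (0 <= \int[P]_xi (g xi)%:E)%E.
  by apply: integral_ge0 => xi _; rewrite lee_fin.
have fn : (\int[P]_xi (g xi)%:E)%E \is a fin_num.
  by rewrite ge0_fin_numE// (le_lt_trans gB)// ltry.
exists (fine (\int[P]_xi (g xi)%:E)%E); last by rewrite -lee_fin fineK.
split; last by rewrite fineK.
apply/integrableP; split; first exact/measurable_EFinP.
under eq_integral do rewrite gee0_abs ?lee_fin//.
by rewrite -ge0_fin_numE.
Qed.

(** As [f >= 0], [g] can be negative only on a null set, so truncating it at 0 preserves its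
    mean. *)
Lemma lower_integral_le_mean (f g : T -> R) r :
  (forall xi, 0 <= f xi) -> has_mean g r -> {ae P, forall xi, f xi <= g xi} ->
  (\int[P]_xi (f xi)%:E <= r%:E)%E.
Proof.
move=> f0 [gi gr] fg.
have mg : measurable_fun setT g by case/integrableP: gi => /measurable_EFinP.
have mg0 : measurable_fun setT (fun xi => Num.max (g xi) 0).
  by apply: measurable_maxr => //; exact: measurable_cst.
apply: (@le_trans _ _ (\int[P]_xi (Num.max (g xi) 0)%:E)%E).
  apply: ae_ge0_le_lower_integral => //.
  - by move=> xi; rewrite lee_fin le_max lexx orbT.
  - exact/measurable_EFinP.
  - by apply: filterS fg => xi fgx; rewrite lee_fin le_max fgx.
rewrite -gr le_eqVlt; apply/orP; left; apply/eqP.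
apply: ae_eq_integral => //; [exact/measurable_EFinP|exact/measurable_EFinP|].
apply: filterS fg => xi fgx _; congr EFin.
by apply/max_idPl; exact: le_trans (f0 xi) fgx.
Qed.

End IterExpect.

(** * Contraction in expectation for one step *)

Section ExpectedStep.
Context {R : realType} {d : nat} {d0 : measure_display} {Xi : measurableType d0}.
Context (P : probability Xi R).

Lemma measurable_sqnorm (u : Xi -> 'rV[R]_d) :
  (forall i, measurable_fun setT (fun xi => u xi 0 i)) ->
  measurable_fun setT (fun xi => sqnorm (u xi)).
Proof.
move=> mu; apply: measurable_sum => i; exact: measurable_funM.
Qed.

Lemma has_mean_dotv (G : Xi -> 'rV[R]_d) (g t : 'rV[R]_d) :
  (forall i, has_mean P (fun xi => G xi 0 i) (g 0 i)) ->
  has_mean P (fun xi => dotv t (G xi)) (dotv t g).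
Proof. by move=> hG; apply: has_mean_sum => i; exact: has_meanZ. Qed.

(** Interpolation removes [Gs] almost surely, so star similarity becomes a variance bound. *)
Lemma noise_second_moment (G Gs : Xi -> 'rV[R]_d) (g : 'rV[R]_d) B :
  (forall i, has_mean P (fun xi => G xi 0 i) (g 0 i)) ->
  (forall i, measurable_fun setT (fun xi => Gs xi 0 i)) ->
  {ae P, forall xi, Gs xi = 0} ->
  (\int[P]_xi (sqnorm (G xi - g - Gs xi))%:E <= B%:E)%E ->
  exists2 r, has_mean P (fun xi => sqnorm (G xi - g)) r & r <= B.
Proof.
move=> hG mGs Gs0 hB.
have mG i : measurable_fun setT (fun xi => (G xi - g) 0 i).
  under eq_fun do rewrite !mxE.
  apply: measurable_funB; last exact: measurable_cst.
  by have [/integrableP[/measurable_EFinP]] := hG i.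
have mGG i : measurable_fun setT (fun xi => (G xi - g - Gs xi) 0 i).
  rewrite (_ : (fun _ => _) = (fun xi => (G xi - g) 0 i - Gs xi 0 i)).
    exact: measurable_funB.
  by apply/funext => xi; rewrite !mxE.
apply: has_mean_bounded.
- exact: measurable_sqnorm.
- by move=> xi; exact: sqnorm_ge0.
apply: le_trans hB; rewrite le_eqVlt; apply/orP; left; apply/eqP.
apply: ae_eq_integral => //.
- by apply/measurable_EFinP; exact: measurable_sqnorm.
- by apply/measurable_EFinP; exact: measurable_sqnorm.
by apply: filterS Gs0 => xi -> _; rewrite subr0.
Qed.

(** The available decrease is at least [kappa] times the one for an inexactness of [1 - theta]. The
    sign condition on [(1 - theta) * (4 - gamma * mu)] means [theta = 1] or [gamma * mu <= 4]. *)
Lemma expected_step_le (F : Xi -> 'rV[R]_d -> R) (gF : Xi -> 'rV[R]_d -> 'rV[R]_d)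
    (f : 'rV[R]_d -> R) (gf : 'rV[R]_d -> 'rV[R]_d) (mu delta : R)
    (xs x : 'rV[R]_d) (xh : Xi -> 'rV[R]_d) (gamma theta kappa c b : R) :
  (forall x, has_mean P (F^~ x) (f x)) ->
  (forall x, has_gradient_at f x (gf x)) ->
  (forall x i, has_mean P (fun xi => gF xi x 0 i) (gf x 0 i)) ->
  {ae P, forall xi, forall x, has_gradient_at (F xi) x (gF xi x)} ->
  {ae P, forall xi, convexf (F xi)} ->
  0 < mu -> strongly_convex mu f gf ->
  (forall x, f xs <= f x) ->
  {ae P, forall xi, gF xi xs = 0} ->
  0 < delta ->
  (forall x, (\int[P]_xi (sqnorm (gF xi x - gf x - gF xi xs))%:E <=
              (delta ^+ 2 * sqnorm (x - xs))%:E)%E) ->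
  0 < gamma -> gamma <= mu / (4 * delta ^+ 2) ->
  (forall xi p,
    (forall y, F xi p + (2 * gamma)^-1 * sqnorm (p - x) <=
               F xi y + (2 * gamma)^-1 * sqnorm (y - x)) ->
    sqnorm (gamma *: gF xi (xh xi) + (xh xi - x)) <= c * sqnorm (x - p)) ->
  0 < theta -> theta <= 1 -> 0 <= (1 - theta) * (4 - gamma * mu) ->
  0 <= kappa -> kappa <= 1 -> kappa * theta <= 1 - c -> 0 <= b ->
  (\int[P]_xi (b * sqnorm (x - gamma *: gF xi (xh xi) - xs))%:E <=
   (b * (1 - kappa * Num.min (gamma * mu / 4) (theta / 2)) *
    sqnorm (x - xs))%:E)%E.
Proof.
move=> hF hgf hgF A1 A2 mu0 sc fmin A4 del0 SS g0 gle IP th0 th1 th4 k0 k1 kth b0.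
have gfs : gf xs = 0.
  apply/esym/dotv_le_eq => v; rewrite -(scale0r v) dotvZl mul0r.
  apply: (gradient_dir_ge (C := 0) (hgf xs)) => t _.
  by rewrite !mulr0 subr0 subr_ge0.
have fof y w : f y + dotv (gf y) (w - y) <= f w.
  apply: le_trans (sc y w); rewrite lerDl mulr_ge0 ?sqnorm_ge0 //.
  by rewrite divr_ge0 // ltW.
have g2 : 0 < (2 * gamma)^-1 by rewrite invr_gt0 mulr_gt0.
have gE : gamma * (2 * (2 * gamma)^-1) = 1 by field; rewrite gt_eqF.
have [z' [_ gz']] := exists_prox x g2 hgf fof.
pose k := x - z'.
have {}gz' : gamma *: gf z' = k by rewrite gz' scalerA gE scale1r.
have l0 : 0 < 2 - theta by lra.
(* Centre and parameter are chosen so that the optimality condition reads [gamma grad f(z) = (2 -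
   theta) t + theta k]. *)
have [z [_ gz]] := exists_prox (z' + (theta / (2 - theta)) *: k)
  (mulr_gt0 l0 g2) hgf fof.
pose t := z' - z.
have {}gz : gamma *: gf z = (2 - theta) *: t + theta *: k.
  rewrite gz; have -> : z' + (theta / (2 - theta)) *: k - z =
      t + (theta / (2 - theta)) *: k by rewrite addrAC.
  rewrite scalerA scalerDr scalerA; congr (_ *: _ + _ *: _).
    by field; rewrite gt_eqF.
  by field; rewrite !gt_eqF.
have mgs i : measurable_fun setT (fun xi => gF xi xs 0 i).
  by have [/integrableP[/measurable_EFinP]] := hgF xs i.
have zt : z' - t = z by rewrite subKr.
have kz : x - z' = k by [].
clearbody t k.
have [r hr rle] := noise_second_moment (hgF z) mgs A4 (SS z).
have [r' hr' rle'] := noise_second_moment (hgF z') mgs A4 (SS z').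
pose S := sqnorm (x - xs).
(* This equals [2 (1 - theta) |t|^2 + theta |k + t|^2], where [k + t = x - z]. *)
pose C0 := (2 - theta) * sqnorm t + 2 * theta * dotv k t + theta * sqnorm k.
(* Mean of the upper bound, which involves only deterministic points: the noise paired with [t]
   averages to 0, leaving the second moments [r] and [r']. *)
have hU := has_meanZ b (has_meanD (has_mean_cst P S) (has_meanZ (- kappa)
  (has_meanD (has_meanD (has_meanZ (2 * gamma)
     (has_meanD (hF z) (has_meanN (hF xs)))) (has_mean_cst P C0))
  (has_meanD (has_meanZ (- (2 * (1 - theta) * gamma))
     (has_meanD (has_mean_dotv t (hgF z')) (has_mean_cst P (- dotv t (gf z')))))
  (has_meanD (has_meanZ (- gamma ^+ 2) hr)
     (has_meanZ (- ((1 - theta) * gamma ^+ 2)) hr')))))).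
apply: (le_trans (lower_integral_le_mean _ hU _)).
- by move=> xi; rewrite mulr_ge0 ?sqnorm_ge0.
- apply: filterS3 A1 A2 A4 => xi hg cv gs0.
  have fo y w : F xi y + dotv (gF xi y) (w - y) <= F xi w.
    exact: convex_first_order.
  have [p [pmin gp]] := exists_prox x g2 hg fo.
  have {}gp : gamma *: gF xi p = x - p by rewrite gp scalerA gE scale1r.
  have d1 := inexact_prox_descent xs g0 fo gp (IP xi p pmin).
  have e1 : gamma *: gF xi z' = x - z' + gamma *: (gF xi z' - gf z').
    by rewrite kz scalerBr gz' addrC subrK.
  have e2 : gamma *: gF xi (z' - t) =
      (2 - theta) *: t + theta *: (x - z') + gamma *: (gF xi z - gf z).
    by rewrite kz zt scalerBr gz addrC subrK.
  have := prox_gap_ge xs g0 th1 fo gp e1 e2.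
  rewrite zt kz !sqnormZ dotvZr dotvDr dotvNr => d2.
  (* Interpolation makes [xs] minimize almost every sample function, so the gap may be scaled down
     by [kappa]. *)
  have ps : F xi xs <= F xi p.
    have := fo xs p; rewrite gs0.
    by rewrite -(scale0r (p - xs)) dotvZl mul0r addr0.
  rewrite ler_wpM2l //= (le_trans d1) // /S /C0.
  set U := sqnorm (x - p) in d2 *.
  have U0 : 0 <= U by exact: sqnorm_ge0.
  have A0 : 0 <= (1 - kappa) * (2 * gamma * (F xi p - F xi xs)).
    by rewrite !mulr_ge0 ?subr_ge0 // ltW.
  have B0 : 0 <= (1 - c - kappa * theta) * U by rewrite mulr_ge0 ?subr_ge0.
  have := ler_wpM2l k0 d2.
  lra.
rewrite lee_fin -[leRHS]mulrA ler_wpM2l //.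
(* With [m = gamma mu], the noise at [z] costs at most [m/4 |z - xs|^2], against the gain
   [m |z - xs|^2] from strong convexity in [n4]; hence the coefficient 3/4. *)
have gd : gamma * delta ^+ 2 <= mu / 4.
  move: gle; rewrite ler_pdivlMr ?mulr_gt0 ?exprn_gt0 //; lra.
have n1 : gamma ^+ 2 * r <= gamma * mu / 4 * sqnorm (z - xs).
  apply: (@le_trans _ _ (gamma ^+ 2 * (delta ^+ 2 * sqnorm (z - xs)))).
    by rewrite ler_wpM2l ?sqr_ge0.
  rewrite mulrA ler_wpM2r ?sqnorm_ge0 // expr2 -!mulrA ler_wpM2l // ltW //.
have n2 : gamma ^+ 2 * r' <= gamma * mu / 4 * sqnorm (z' - xs).
  apply: (@le_trans _ _ (gamma ^+ 2 * (delta ^+ 2 * sqnorm (z' - xs)))).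
    by rewrite ler_wpM2l ?sqr_ge0.
  rewrite mulrA ler_wpM2r ?sqnorm_ge0 // expr2 -!mulrA ler_wpM2l // ltW //.
have n3 := ler_wpM2l (_ : 0 <= 1 - theta) n2.
move: n3; rewrite subr_ge0 => /(_ th1) n3.
have n4 : gamma * mu * sqnorm (z - xs) <= 2 * gamma * (f z - f xs).
  have := sc xs z; rewrite gfs -(scale0r (z - xs)) dotvZl mul0r addr0.
  rewrite -(ler_pM2l g0); lra.
have := rate_small_step (z - xs) t (x - z) (mulr_gt0 g0 mu0) th4 th0 th1.
have -> : z - xs + t = z' - xs by rewrite -zt addrAC subrK.
have -> : z - xs + (x - z) = x - xs by rewrite addrC addrA subrK.
have -> : x - z = k + t by rewrite -zt -kz opprB addrA addrAC.
rewrite -/S => n5.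
have n6 : sqnorm (k + t) = sqnorm k + 2 * dotv k t + sqnorm t.
  by rewrite /sqnorm !dotvE (dotvC t k); ring.
rewrite n6 in n5.
have n7 : Num.min (gamma * mu / 4) (theta / 2) * S <=
    2 * gamma * (f z - f xs) + C0 - gamma ^+ 2 * r
    - (1 - theta) * (gamma ^+ 2 * r') by rewrite /C0; lra.
have := ler_wpM2l k0 n7; lra.
Qed.

End ExpectedStep.

Theorem theorem6p2 (R : realType) (d : nat)
  (d0 : measure_display) (Xi : measurableType d0) (D : probability Xi R)
  (F : Xi -> 'rV[R]_d -> R) (gF : Xi -> 'rV[R]_d -> 'rV[R]_d)
  (f : 'rV[R]_d -> R) (gf : 'rV[R]_d -> 'rV[R]_d)
  (mu delta : R) (xs : 'rV[R]_d)
  (gamma eta alpha c : R) (T : nat)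
  (x0 : 'rV[R]_d) (xhat : seq Xi -> 'rV[R]_d) :
  (* f(x) = E[f_xi(x)] and grad f(x) = E[grad f_xi(x)] *)
  (forall x, D.-integrable setT (fun xi => (F xi x)%:E) /\
             (\int[D]_xi (F xi x)%:E)%E = (f x)%:E) ->
  (forall x, has_gradient_at f x (gf x)) ->
  (forall x (i : 'I_d), D.-integrable setT (fun xi => (gF xi x 0 i)%:E) /\
             (\int[D]_xi (gF xi x 0 i)%:E)%E = (gf x 0 i)%:E) ->
  (* (A1) differentiability, gF xi is the gradient of f_xi *)
  {ae D, forall xi, forall x, has_gradient_at (F xi) x (gF xi x)} ->
  (* (A2) convexity *)
  {ae D, forall xi, convexf (F xi)} ->
  (* (A3) mu-strong convexity of f *)
  0 < mu -> strongly_convex mu f gf ->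
  (* xs is a minimizer of f satisfying (A4) interpolation *)
  (forall x, f xs <= f x) ->
  {ae D, forall xi, gF xi xs = 0} ->
  (* (SS) star similarity with constant delta *)
  0 < delta ->
  (forall x, (\int[D]_xi (sqnorm (gF xi x - gf x - gF xi xs))%:E <=
              (delta ^+ 2 * sqnorm (x - xs))%:E)%E) ->
  (* (IP): inexact prox condition at every iteration *)
  0 < eta -> 0 < alpha -> (0 < T)%N ->
  (forall (h : seq Xi) (xi : Xi) (xPsi : 'rV[R]_d),
     let xk := sppm_iterate gF gamma x0 xhat h in
     let Psi := fun x => F xi x + (2 * gamma)^-1 * sqnorm (x - xk) in
     (forall y, Psi xPsi <= Psi y) ->
     sqnorm (gF xi (xhat (xi :: h)) + gamma^-1 *: (xhat (xi :: h) - xk))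
       <= eta * sqnorm (xk - xPsi) / (T%:R `^ alpha)) ->
  (* step size and inner-iteration conditions *)
  0 < gamma -> gamma <= mu / (4 * delta ^+ 2) ->
  eta * gamma ^+ 2 / (T%:R `^ alpha) <= c -> c < 1 ->
  forall k : nat,
    (iter_expect D k
       (fun h => (sqnorm (sppm_iterate gF gamma x0 xhat h - xs))%:E)
     <= ((1 - Num.min (gamma * mu / 4) ((1 - c) / 2)) ^+ k
          * sqnorm (x0 - xs))%:E)%E.
Proof.
move=> hF hgf hgF A1 A2 mu0 sc fmin A4 del0 SS eta0 al0 T0 IP g0 gle hc c1 k.
have Ta0 : 0 < T%:R `^ alpha :> R by rewrite powR_gt0 // ltr0n.
have c0 : 0 < c.
  by apply: lt_le_trans hc; rewrite divr_gt0 // mulr_gt0 // exprn_gt0.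
pose V h := sqnorm (sppm_iterate gF gamma x0 xhat h - xs).
set q := 1 - _.
have q0 : 0 <= q.
  have : Num.min (gamma * mu / 4) ((1 - c) / 2) <= (1 - c) / 2.
    by rewrite ge_min lexx orbT.
  rewrite /q; lra.
have V0 h : 0 <= V h by exact: sqnorm_ge0.
have IP' h xi p :
    (forall y, F xi p + (2 * gamma)^-1 *
                 sqnorm (p - sppm_iterate gF gamma x0 xhat h) <=
               F xi y + (2 * gamma)^-1 *
                 sqnorm (y - sppm_iterate gF gamma x0 xhat h)) ->
    sqnorm (gamma *: gF xi (xhat (xi :: h))
            + (xhat (xi :: h) - sppm_iterate gF gamma x0 xhat h)) <=
    c * sqnorm (sppm_iterate gF gamma x0 xhat h - p).
  move=> /IP {}IP.
  have -> : xhat (xi :: h) - sppm_iterate gF gamma x0 xhat h =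
      gamma *: (gamma^-1 *: (xhat (xi :: h) - sppm_iterate gF gamma x0 xhat h)).
    by rewrite scalerA divff ?scale1r // gt_eqF.
  rewrite -scalerDr sqnormZ.
  apply: (le_trans (ler_wpM2l (sqr_ge0 gamma) IP)).
  apply: le_trans (ler_wpM2r (sqnorm_ge0 _) hc).
  by rewrite le_eqVlt; apply/orP; left; apply/eqP; ring.
have step h b : 0 <= b ->
    (\int[D]_xi (b * V (xi :: h))%:E <= (b * q * V h)%:E)%E.
  move=> b0.
  (* Take [theta = 1 - c], [kappa = 1] for small steps. For large ones take [theta = 1],
     [kappa = 1 - c]: the minimum is then [1 / 2], giving the rate [(1 - c) / 2]. *)
  have [m4|m4] := leP (gamma * mu) 4.
    have th4 : 0 <= (1 - (1 - c)) * (4 - gamma * mu).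
      by rewrite mulr_ge0 ?subr_ge0 // gerBl ltW.
    have := expected_step_le (kappa := 1) hF hgf hgF A1 A2 mu0 sc fmin A4 del0
      SS g0 gle (IP' h) _ _ th4 _ _ _ b0.
    rewrite !mul1r; apply; lra.
  have th4 : 0 <= (1 - 1) * (4 - gamma * mu) by rewrite subrr mul0r.
  have k0 : 0 <= 1 - c by rewrite subr_ge0 ltW.
  have k1 : 1 - c <= 1 by rewrite gerBl ltW.
  have k2 : (1 - c) * 1 <= 1 - c by rewrite mulr1.
  apply: (le_trans (expected_step_le hF hgf hgF A1 A2 mu0 sc fmin A4 del0
    SS g0 gle (IP' h) ltr01 (lexx 1) th4 k0 k1 k2 b0)).
  rewrite lee_fin; apply: ler_wpM2r; first exact: V0.
  apply: ler_wpM2l => //.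
  rewrite /q lerD2l lerN2.
  have -> : Num.min (gamma * mu / 4) (1 / 2) = 1 / 2 by apply/min_idPr; lra.
  by rewrite mul1r ge_min lexx orbT.
have := iter_expect_geometric k q0 V0 step ler01.
rewrite mul1r; under [X in iter_expect D k X]eq_fun do rewrite mul1r.
by [].
Qed.
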